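(* Let $p$ be a prime with $p\equiv1\pmod 4$, let $K=\mathbb{F}_p$, and suppose $\phi\in K(x)$ is M\''obius-conjugate over $K$ to $\frac{x^2+a}{x^2-a}$, where $a\in K$ satisfies $a^2+1=0$. Then $$\liminf_{n\to\infty}\frac{\#\mathrm{Per}(\phi,\mathbb{P}^1(\mathbb{F}_{p^n}))}{p^n+1}\ge\frac18.$$
   Context: $\mathrm{Per}(\phi,S)$ denotes the set of periodic points of $\phi$ in $S$. *)

(* Defs.v *)
From mathcomp Require Export all_boot all_order all_algebra.
From mathcomp Require Export fraction.
From mathcomp Require Export all_classical all_reals.
From mathcomp Require Export topology normedtype sequences.

Set Implicit Arguments.
Unset Strict Implicit.
Unset Printing Implicit Defensive.

Import Order.TTheory GRing.Theory Num.Theory.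

Local Open Scope ring_scope.

Notation "x %:F" := (@FracField.tofrac _ x) : ring_scope.

Notation ratfun K := {fraction {poly K}}.

(* P^1(L) = L together with the point at infinity, represented by None. *)
Notation P1 L := (option L).

Section RationalFunctions.
Variable K : fieldType.
Implicit Types (f g : ratfun K) (M : 'M[K]_2).

(* Numerator and denominator in lowest terms, defined up to a common nonzero
   scalar. *)
Definition rnum f : {poly K} :=
  let r := repr f in \n_r %/ gcdp \n_r \d_r.

Definition rden f : {poly K} :=
  let r := repr f in \d_r %/ gcdp \n_r \d_r.

Lemma rden_neq0 f : rden f != 0.
Proof. by rewrite dvdp_div_eq0 ?dvdp_gcdr // denom_ratioP. Qed.

Lemma coprimep_rnum_rden f : coprimep (rnum f) (rden f).
Proof. by rewrite coprimep_div_gcd // denom_ratioP orbT. Qed.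

Lemma ratfunE f : f = (rnum f)%:F / (rden f)%:F.
Proof.
have d0 : (rden f)%:F != 0 :> ratfun K by rewrite tofrac_eq0 rden_neq0.
apply: (mulIf d0); rewrite divfK //.
rewrite /rnum /rden; set r := repr f; set g := gcdp _ _.
have g0 : g%:F != 0 :> ratfun K.
  by rewrite tofrac_eq0 gcdp_eq0 negb_and denom_ratioP orbT.
apply: (mulIf g0); rewrite -mulrA -!tofracM.
rewrite !divpK ?dvdp_gcdl ?dvdp_gcdr //.
rewrite -[f]reprK -/r -[r]Ratio_numden.
rewrite !numden_Ratio ?denom_ratioP //.
unlock FracField.tofrac.
rewrite !piE /FracField.mulf !numden_Ratio ?denom_ratioP ?oner_neq0 //.
apply/eqP; rewrite mulr1 FracField.equivf_def.
by rewrite /FracField.equivf !numden_Ratio ?mulr1 ?oner_neq0 ?denom_ratioP // mulrC.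
Qed.

(* Composition f(g(x)); meaningful unless g is a constant that is a pole
   of f. *)
Definition rcomp f g : ratfun K :=
  let ev (q : {poly K}) := (map_poly (fun c => c%:P%:F) q).[g] in
  ev (rnum f) / ev (rden f).

Definition mobius M : ratfun K :=
  (M 0 0 *: 'X + (M 0 1)%:P)%:F / (M 1 0 *: 'X + (M 1 1)%:P)%:F.

Definition mobius_conjugate f g : Prop :=
  exists2 M : 'M[K]_2,
    M \in unitmx & f = rcomp (mobius (invmx M)) (rcomp g (mobius M)).

(* Since numerator and denominator are coprime over K, they have no common
   zero in any extension L. At infinity the value is the quotient of the
   coefficients of degree deg f = max(deg rnum f, deg rden f). *)
Definition ratmap (L : fieldType) (iota : {rmorphism K -> L}) f
    (x : P1 L) : P1 L :=
  let n := map_poly iota (rnum f) in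
  let d := map_poly iota (rden f) in
  let quot (u v : L) : P1 L := if v == 0 then None else Some (u / v) in
  match x with
  | Some t => quot n.[t] d.[t]
  | None => let e := (maxn (size n) (size d)).-1 in quot n`_e d`_e
  end.

End RationalFunctions.

Definition periodic (T : Type) (f : T -> T) (x : T) : Prop :=
  exists2 n : nat, (0 < n)%N & iter n f x = x.

Definition nPer (K : fieldType) (L : finFieldType) (iota : {rmorphism K -> L})
    (f : ratfun K) : nat :=
  #|[pred x : P1 L | `[< periodic (ratmap iota f) x >]]|.

(* Main.v *)
Require Import Defs.
From mathcomp Require Import fingroup cyclic finfield ereal.
From mathcomp Require Import ring lra zify.

Set Implicit Arguments.
Unset Strict Implicit.
Unset Printing Implicit Defensive.

Import Order.TTheory GRing.Theory Num.Theory.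
Local Open Scope ring_scope.

(** The map [g = (x^2 + a) / (x^2 - a)] is a Lattes map: it is induced by
    multiplication by [1 + i] on the curve [y^2 = x^4 - 1] and on its quadratic
    twist, and the points of odd order are periodic. Let [chi] be the quadratic
    character of [F_q] and let [T] be the set of the [t] with
      [chi (a (t^2 - 1)) = 1], [chi (a (a - 1) (t - a) (t - 1)) = 1] and
      [chi (t^4 - 1) = -1].
    The first condition says that [t] has two preimages [y, -y] under [g]; the
    second one, that [y] and [-y] satisfy the first condition; the third one is
    invariant under [g], as [g(x)^4 - 1 = 8 a x^2 (x^4 - 1) / (x^2 - a)^4] and
    [8 a = (2 (1 + a))^2]. The values of the second expression at [y] and [-y]
    multiply to [y^4 - 1] up to a square, so exactly one of [y, -y] is in [T].
    Hence [g] permutes [T].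

    Expanding [8 #|T|] as a character sum, every term but [sum_t chi (t^4 - 1)]
    is quadratic and hence bounded; that term is [O(sqrt q)] by the second
    moment of [c |-> sum_t chi (t^4 - c)]. *)

Section QuadraticCharacter.
Variable L : finFieldType.
Hypothesis odd_card : odd #|L|.

Definition qchar (x : L) : int :=
  if x == 0 then 0 else if x ^+ (#|L|.-1)./2 == 1 then 1 else -1.

Lemma two_neq0 : 2%:R != 0 :> L.
Proof.
apply/eqP => two0; have /eqP := expg_cardG (finset.in_setT (1 : L)).
rewrite FinRing.zmodXgE FinRing.zmod1gE cardsT -(odd_double_half #|L|) odd_card.
by rewrite -mul2n mulrnDr mulrnA two0 mul0rn addr0 oner_eq0.
Qed.

Lemma card_predE : #|L|.-1 = (#|L|.-1)./2.*2.
Proof. by move: odd_card; lia. Qed.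

Lemma card_pred_gt0 : (0 < #|L|.-1)%N.
Proof. by have lt1 : (1 < #|L|)%N := finNzRing_gt1 L; lia. Qed.

Lemma expf_card_pred (x : L) : x != 0 -> x ^+ #|L|.-1 = 1.
Proof.
move=> x0; apply: (mulfI x0).
by rewrite -exprS mulr1 prednK ?expf_card // ltnW ?finNzRing_gt1.
Qed.

Lemma half_powerP (x : L) : x != 0 ->
  {x ^+ (#|L|.-1)./2 = 1} + {x ^+ (#|L|.-1)./2 = -1}.
Proof.
move=> /expf_card_pred; rewrite {1}card_predE -mul2n mulnC exprM => /eqP.
by rewrite sqrf_eq1; case: eqP => [-> _|_ /eqP ->]; [left | right].
Qed.

Lemma oppr1_neq1 : (-1 : L) != 1.
Proof. by rewrite -subr_eq0 -opprD oppr_eq0 two_neq0. Qed.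

Lemma qchar0 : qchar 0 = 0. Proof. by rewrite /qchar eqxx. Qed.

Lemma qchar1 : qchar 1 = 1. Proof. by rewrite /qchar oner_eq0 expr1n eqxx. Qed.

Lemma qcharM x y : qchar (x * y) = qchar x * qchar y.
Proof.
rewrite /qchar mulf_eq0.
have [->|x0] := eqVneq x 0; first by rewrite /= mul0r.
have [->|y0] := eqVneq y 0; first by rewrite orbT mulr0.
rewrite exprMn /=.
case: (half_powerP x0) => ->; case: (half_powerP y0) => ->;
  by rewrite ?mul1r ?mulr1 ?mulrNN ?mulr1 ?eqxx ?(negbTE oppr1_neq1).
Qed.

Lemma qchar_sqr x : x != 0 -> qchar (x ^+ 2) = 1.
Proof.
move=> x0; rewrite /qchar expf_eq0 (negbTE x0) -exprM mul2n -card_predE.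
by rewrite expf_card_pred // eqxx.
Qed.

Lemma qcharM_sqr x y : y != 0 -> qchar (x * y ^+ 2) = qchar x.
Proof. by move=> y0; rewrite qcharM qchar_sqr // mulr1. Qed.

Lemma qchar_eq0 x : (qchar x == 0) = (x == 0).
Proof. by rewrite /qchar; case: ifP => // _; case: ifP. Qed.

Lemma qcharP x : x != 0 -> (qchar x == 1) || (qchar x == -1).
Proof. by rewrite /qchar => /negbTE ->; case: ifP. Qed.

Lemma qchar_bound x : -1 <= qchar x <= 1.
Proof. by rewrite /qchar; case: ifP => // _; case: ifP. Qed.

Lemma qchar_normM x : qchar x * qchar x = (x != 0)%:R.
Proof. by rewrite /qchar; case: ifP => // _; case: ifP. Qed.

Lemma exists_primitive_root : exists z : L, (#|L|.-1).-primitive_root z.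
Proof.
have n_gt0 := card_pred_gt0.
have /hasP[z _ zP] : has (#|L|.-1).-primitive_root (enum [set~ (0 : L)]).
  apply: has_prim_root => //; last 2 first.
  - exact: enum_uniq.
  - by rewrite -cardE cardsC1.
  apply/allP => x; rewrite mem_enum !inE => x0.
  by rewrite unity_rootE expf_card_pred.
by exists z.
Qed.

Lemma qchar_eq1_sqr x : qchar x = 1 -> exists2 y, y != 0 & x = y ^+ 2.
Proof.
rewrite /qchar; case: (eqVneq x 0) => // x0; case: eqP => // xm _.
have [z zP] := exists_primitive_root.
have [i xi] := prim_rootP zP (expf_card_pred x0).
have n_gt0 := card_pred_gt0.
have : (#|L|.-1 %| i * (#|L|.-1)./2)%N.
  by rewrite (prim_order_dvd zP) exprM -xi xm.
rewrite {1}card_predE -mul2n dvdn_pmul2r; last by move: n_gt0 odd_card; lia.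
rewrite dvdn2 => /negbTE i_even; exists (z ^+ i./2).
  by rewrite expf_neq0 // (prim_root_eq0 zP) -lt0n.
by rewrite -exprM muln2 xi -{1}(odd_double_half i) i_even.
Qed.

Lemma exists_qchar_eqN1 : exists2 z, z != 0 & qchar z = -1.
Proof.
have [z zP] := exists_primitive_root.
have n_gt0 := card_pred_gt0.
have z0 : z != 0 by rewrite (prim_root_eq0 zP) -lt0n.
exists z => //; rewrite /qchar (negbTE z0) -(prim_order_dvd zP).
case: ifP => // /dvdn_leq; move: n_gt0 odd_card; lia.
Qed.

Lemma sum_qchar : \sum_x qchar x = 0.
Proof.
have [z z0 zN] := exists_qchar_eqN1.
suff : \sum_x qchar x = - \sum_x qchar x by lia.
rewrite {1}(reindex_inj (mulfI z0)) -sumrN.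
by apply: eq_bigr => x _; rewrite qcharM zN mulN1r.
Qed.

(* Away from [c], [(t - b) / (t - c)] runs over every value but [1]. *)
Lemma sum_qchar_quadratic (b c : L) : b != c ->
  \sum_t qchar ((t - b) * (t - c)) = -1.
Proof.
move=> bc; rewrite (bigD1 c) //= subrr mulr0 qchar0 add0r.
have cb0 : c - b != 0 by rewrite subr_eq0 eq_sym.
pose f (u : L) : L := c + (c - b) / (u - 1).
rewrite (reindex_onto f (fun t => 1 + (c - b) / (t - c))) /=; last first.
  move=> t tc; rewrite /f addrAC subrr add0r invf_div mulrC divfK //.
  by rewrite addrC subrK.
have -> : -1 = \sum_(u : L | u != 1) qchar u.
  have /eqP := sum_qchar; rewrite (bigD1 1) //= qchar1 addrC addr_eq0.
  by move=> /eqP.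
apply: eq_big => [u|u /andP[fc _]].
  rewrite /f -(subr_eq0 _ c) addrAC subrr add0r mulf_eq0 invr_eq0 (negbTE cb0).
  rewrite /= subr_eq0; case: eqVneq => //= u1.
  by rewrite invf_div mulrC divfK // addrC subrK eqxx.
have u1 : u - 1 != 0.
  by apply: contraNneq fc => u1; rewrite /f u1 invr0 mulr0 addr0.
have -> : (f u - b) * (f u - c) = u * ((c - b) / (u - 1)) ^+ 2.
  by rewrite /f; field.
by rewrite qcharM_sqr // mulf_neq0 ?invr_eq0.
Qed.

Lemma card_quartic_fiber (c : L) : (#|[set u : L | u ^+ 4 == c]| <= 4)%N.
Proof.
have sz : size ('X^4 - c%:P) = 5%N by rewrite size_XnsubC.
have p0 : 'X^4 - c%:P != 0 by rewrite -size_poly_gt0 sz.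
rewrite cardE -ltnS -sz; apply: max_poly_roots => //; last exact: enum_uniq.
apply/allP => x; rewrite mem_enum inE => /eqP xc.
by rewrite rootE !hornerE xc subrr.
Qed.

Let S (c : L) : int := \sum_t qchar (t ^+ 4 - c).

Lemma sum_qchar_quartic_scale (u : L) : u != 0 -> S (u ^+ 4) = S 1.
Proof.
move=> u0; rewrite /S (reindex_inj (mulfI u0)); apply: eq_bigr => t _.
rewrite -(qcharM_sqr (_ - 1) (y := u ^+ 2)) ?expf_neq0 //.
by congr qchar; ring.
Qed.

Lemma sum_qchar_correlation (x y : L) :
  \sum_c qchar (x - c) * qchar (y - c) = (if x == y then #|L|%:R else 0) - 1.
Proof.
have [<-|xy] := eqVneq x y.
  rewrite (bigD1 x) //= qchar_normM subrr eqxx add0r.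
  rewrite (eq_bigr (fun=> 1)) => [|c cx]; last first.
    by rewrite qchar_normM subr_eq0 eq_sym cx.
  rewrite sumr_const cardC1 -subn1 natrB //; exact: ltnW (finNzRing_gt1 L).
rewrite sub0r -(sum_qchar_quadratic xy); apply: eq_bigr => c _.
by rewrite -qcharM -mulrNN !opprB.
Qed.

Lemma sum_sqr_qchar_quartic :
  \sum_c S c ^+ 2 <= 4 * #|L|%:R ^+ 2.
Proof.
have -> : \sum_c S c ^+ 2 = \sum_(t : L) \sum_(s : L)
    ((if t ^+ 4 == s ^+ 4 then #|L|%:R else 0) - 1).
  transitivity (\sum_c \sum_t \sum_s qchar (t ^+ 4 - c) * qchar (s ^+ 4 - c)).
    apply: eq_bigr => c _; rewrite expr2 /S mulr_suml.
    by apply: eq_bigr => t _; rewrite mulr_sumr.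
  rewrite exchange_big; apply: eq_bigr => t _.
  rewrite exchange_big; apply: eq_bigr => s _; exact: sum_qchar_correlation.
have -> : 4 * #|L|%:R ^+ 2 = \sum_(t : L) (4 * #|L|%:R) :> int.
  by rewrite sumr_const -[RHS]mulr_natr expr2 mulrA.
apply: ler_sum => t _.
apply: (@le_trans _ _ (\sum_s (if t ^+ 4 == s ^+ 4 then #|L|%:R else 0))).
  by apply: ler_sum => s _; rewrite gerDl oppr_le0.
rewrite -big_mkcond sumr_const -[X in X <= _]mulr_natl ler_wpM2r //.
rewrite (ler_nat _ _ 4); apply: leq_trans (card_quartic_fiber (t ^+ 4)).
rewrite cardsE; apply: eq_leq; apply: eq_card => s; exact: eq_sym.
Qed.

(* The second moment of [c |-> S c] is small while [S] is constant on the
   orbits [c u^4]: a weak Hasse bound for the curve [y^2 = t^4 - 1]. *)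
Lemma sum_qchar_quartic_bound :
  (\sum_t qchar (t ^+ 4 - 1)) ^+ 2 * (#|L|%:R - 1) <= 16 * #|L|%:R ^+ 2.
Proof.
rewrite -/(S 1).
have -> : S 1 ^+ 2 * (#|L|%:R - 1) = \sum_(u | u != 0) S (u ^+ 4) ^+ 2.
  rewrite (eq_bigr (fun=> S 1 ^+ 2)) => [|u u0]; last first.
    by rewrite sum_qchar_quartic_scale.
  rewrite sumr_const cardC1 -[RHS]mulr_natr -subn1 natrB //.
  exact: ltnW (finNzRing_gt1 L).
apply: (@le_trans _ _ (\sum_u S (u ^+ 4) ^+ 2)).
  rewrite [leRHS](bigD1 0) //= lerDr; exact: sqr_ge0.
rewrite (partition_big (fun u : L => u ^+ 4) xpredT) //=.
apply: (@le_trans _ _ (\sum_c 4 * S c ^+ 2)); last first.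
  rewrite -mulr_sumr (_ : 16 = 4 * 4) // -mulrA ler_pM2l //.
  exact: sum_sqr_qchar_quartic.
apply: ler_sum => c _.
rewrite (eq_bigr (fun=> S c ^+ 2)) => [|u /eqP-> //].
rewrite sumr_const -[X in X <= _]mulr_natl ler_wpM2r ?sqr_ge0 //.
rewrite (ler_nat _ _ 4); apply: leq_trans (card_quartic_fiber c).
by rewrite cardsE.
Qed.

Lemma sum_qchar_near_quadratic (w : L -> L) (k b c : L) : b != c ->
  (forall t, w t = 0 -> t ^+ 4 = 1) ->
  -5 <= \sum_t qchar (k * ((t - b) * (t - c)) * w t ^+ 2) <= 5.
Proof.
move=> bc w0.
have near t : `|qchar (k * ((t - b) * (t - c)) * w t ^+ 2)
                - qchar (k * ((t - b) * (t - c)))| <= if t ^+ 4 == 1 then 1 else 0.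
  have [wt0|wt0] := eqVneq (w t) 0; last first.
    by rewrite qcharM_sqr // subrr normr0; case: eqP.
  rewrite (w0 _ wt0) eqxx wt0 expr0n mulr0 qchar0 /=.
  by move: (qchar_bound (k * ((t - b) * (t - c)))); lia.
have sE : \sum_t qchar (k * ((t - b) * (t - c))) = - qchar k.
  rewrite (eq_bigr (fun t => qchar k * qchar ((t - b) * (t - c)))).
    by rewrite -mulr_sumr sum_qchar_quadratic // mulrN1.
  by move=> t _; rewrite qcharM.
have : `|\sum_t qchar (k * ((t - b) * (t - c)) * w t ^+ 2) + qchar k| <= 4.
  rewrite -[qchar k]opprK -sE -sumrB; apply: le_trans (ler_norm_sum _ _ _) _.
  apply: (@le_trans _ _ (\sum_(t : L) if t ^+ 4 == 1 then 1 else 0)).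
    by apply: ler_sum => t _.
  rewrite -big_mkcond /= sumr_const (ler_nat _ _ 4).
  by apply: leq_trans (card_quartic_fiber 1); rewrite cardsE.
by have := qchar_bound k; lia.
Qed.

End QuadraticCharacter.

Section InvariantSet.
Variables (L : finFieldType) (a : L).
Hypotheses (odd_card : odd #|L|) (a_sqr : a ^+ 2 = -1).

Let two0 : 2%:R != 0 :> L := two_neq0 odd_card.

Let a_neq0 : a != 0.
Proof. by rewrite -sqrf_eq0 a_sqr oppr_eq0 oner_eq0. Qed.

Let a_neq c : c ^+ 2 = 1 -> a != c.
Proof.
move=> c1; apply: contraNneq two0 => ac.
by rewrite -[2%:R]/(1 + 1) -{1}c1 -ac a_sqr addrC subrr.
Qed.

Let aN1 : a - 1 != 0. Proof. by rewrite subr_eq0 a_neq ?expr1n. Qed.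

Let aD1 : 1 + a != 0.
Proof. by rewrite addrC -[1]opprK subr_eq0 a_neq // sqrrN expr1n. Qed.

Definition odd_part : {set L} :=
  [set t | [&& qchar (a * (t ^+ 2 - 1)) == 1,
               qchar (a * (a - 1) * ((t - a) * (t - 1))) == 1
             & qchar (t ^+ 4 - 1) == -1]].

Lemma quartic_factor (t : L) :
  t ^+ 4 - 1 = (t - 1) * (t + 1) * ((t - a) * (t + a)).
Proof.
have -> : (t - a) * (t + a) = t ^+ 2 + 1 by ring: a_sqr.
by ring.
Qed.

Lemma odd_part_preimage t : t \in odd_part ->
  exists2 x, x \in odd_part & x ^+ 2 - a != 0 /\ t * (x ^+ 2 - a) = x ^+ 2 + a.
Proof.
rewrite !inE => /and3P[/eqP t1 /eqP t2 /eqP t3].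
have t4 : t ^+ 4 - 1 != 0 by rewrite -qchar_eq0 t3.
have tN1 : t - 1 != 0.
  by apply: contraNneq t4 => e; rewrite quartic_factor e !mul0r.
have tD1 : t + 1 != 0.
  by apply: contraNneq t4 => e; rewrite quartic_factor e mulr0 mul0r.
have [y y0 yE] : exists2 y, y != 0 & a * (t + 1) / (t - 1) = y ^+ 2.
  apply: (qchar_eq1_sqr odd_card); rewrite -t1.
  rewrite -(qcharM_sqr odd_card _ tN1); congr qchar.
  by field.
have xP x : x ^+ 2 = y ^+ 2 ->
  [/\ x ^+ 2 - a != 0, t * (x ^+ 2 - a) = x ^+ 2 + a,
     qchar (a * (x ^+ 2 - 1)) = 1 & qchar (x ^+ 4 - 1) = -1].
  move=> xy; have x0 : x != 0 by rewrite -sqrf_eq0 xy sqrf_eq0.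
  have xa : x ^+ 2 - a = 2%:R * a / (t - 1) by rewrite xy -yE; field.
  have xa0 : x ^+ 2 - a != 0.
    by rewrite xa !mulf_neq0 ?invr_eq0.
  have tx : t * (x ^+ 2 - a) = x ^+ 2 + a by rewrite xy -yE; field.
  split => //.
    rewrite -t2 -[RHS](qcharM_sqr odd_card _ (y := (t - 1)^-1)) ?invr_eq0 //.
    congr qchar; rewrite xy -yE; field: a_sqr => //.
  rewrite -t3 -(qcharM_sqr odd_card (x ^+ 4 - 1)
     (y := 2%:R * (1 + a) * x / (x ^+ 2 - a) ^+ 2)); last first.
    by rewrite !mulf_neq0 ?invr_eq0 ?expf_neq0.
  congr qchar; have -> : t = (x ^+ 2 + a) / (x ^+ 2 - a) by rewrite -tx mulfK.
  field: a_sqr => //.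
pose h x := a * (a - 1) * ((x - a) * (x - 1)).
have hP : qchar (h y) * qchar (h (- y)) = -1.
  have [_ _ _ <-] := xP y erefl.
  rewrite -qcharM // -(qcharM_sqr odd_card (y ^+ 4 - 1) (y := a * (a - 1))).
    by congr qchar; rewrite quartic_factor /h; ring.
  by rewrite mulf_neq0.
have [x xy hx] : exists2 x, x ^+ 2 = y ^+ 2 & qchar (h x) = 1.
  have h0 z : z ^+ 2 = y ^+ 2 -> h z != 0.
    move=> /xP[_ _ _]; apply: contra_eq_neq; rewrite /h => /eqP.
    rewrite mulf_eq0 mulf_eq0 (negbTE a_neq0) (negbTE aN1) /= mulf_eq0.
    by case/orP => /eqP e; rewrite quartic_factor e ?mul0r ?mulr0 qchar0.
  have := qcharP (h0 y erefl); have := qcharP (h0 (- y) (sqrrN y)).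
  case/orP => /eqP h1; case/orP => /eqP h2; move: hP; rewrite h1 h2 => //.
  - by exists (- y); rewrite ?sqrrN.
  - by exists y.
have [xa tx x1 x3] := xP _ xy.
by exists x => //; rewrite inE x1 x3 -/(h x) hx !eqxx.
Qed.

Lemma card_odd_part : exists2 S : int,
  S ^+ 2 * (#|L|%:R - 1) <= 16 * #|L|%:R ^+ 2 &
  #|L|%:R - S - 62 <= 8 * #|odd_part|%:R.
Proof.
exists (\sum_(t : L) qchar (t ^+ 4 - 1)); first exact: sum_qchar_quartic_bound.
pose f1 (t : L) := a * (t ^+ 2 - 1).
pose f2 (t : L) := a * (a - 1) * ((t - a) * (t - 1)).
pose f3 (t : L) : L := t ^+ 4 - 1.
have root4 (t : L) (c : L) : c ^+ 4 = 1 -> t - c = 0 -> t ^+ 4 = 1.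
  by move=> c4 /eqP; rewrite subr_eq0 => /eqP->.
have a4 : a ^+ 4 = 1 by rewrite (exprM a 2 2) a_sqr sqrrN expr1n.
have N14 : (-1) ^+ 4 = 1 :> L by rewrite (exprM _ 2 2) sqrrN !expr1n.
have near (w : L -> L) (k b c : L) (f : L -> L) : b != c ->
    (forall t, w t = 0 -> t ^+ 4 = 1) ->
    (forall t, f t = k * ((t - b) * (t - c)) * w t ^+ 2) ->
    -5 <= \sum_t qchar (f t) <= 5.
  move=> bc w0 fE; have := sum_qchar_near_quadratic odd_card k bc w0.
  by under eq_bigr do rewrite -fE.
have n1N1 : 1 != -1 :> L by rewrite eq_sym oppr1_neq1.
have na1 : a != 1 by apply: a_neq; rewrite expr1n.
have naN1 : a != -1 by apply: a_neq; rewrite sqrrN expr1n.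
have naNa : a != - a.
  by rewrite -subr_eq0 opprK -mulr2n -mulr_natl mulf_neq0.
have s1 : -5 <= \sum_t qchar (f1 t) <= 5.
  apply: (near (fun=> 1) a 1 (-1)) => // [t /eqP|t]; first by rewrite oner_eq0.
  by rewrite /f1; ring.
have s2 : -5 <= \sum_t qchar (f2 t) <= 5.
  apply: (near (fun=> 1) (a * (a - 1)) a 1) => // [t /eqP|t].
    by rewrite oner_eq0.
  by rewrite /f2; ring.
have s12 : -5 <= \sum_t qchar (f1 t * f2 t) <= 5.
  apply: (near (fun t => t - 1) (a * (a * (a - 1))) (-1) a) => [|t|t].
  - by rewrite eq_sym.
  - by apply: root4; rewrite expr1n.
  - by rewrite /f1 /f2; ring.
have s13 : -5 <= \sum_t qchar (f1 t * f3 t) <= 5.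
  apply: (near (fun t => (t - 1) * (t - -1)) a a (- a)) => // [t /eqP|t].
  - by rewrite mulf_eq0 => /orP[] /eqP; apply: root4; rewrite ?expr1n.
  - by rewrite /f1 /f3 quartic_factor; ring.
have s23 : -5 <= \sum_t qchar (f2 t * f3 t) <= 5.
  apply: (near (fun t => (t - 1) * (t - a)) (a * (a - 1)) (-1) (- a))
    => [|t /eqP|t].
  - by rewrite eqr_opp eq_sym.
  - by rewrite mulf_eq0 => /orP[] /eqP; apply: root4; rewrite ?expr1n.
  - by rewrite /f2 /f3 quartic_factor; ring.
have s123 : -5 <= \sum_t qchar (f1 t * f2 t * f3 t) <= 5.
  apply: (near (fun t => (t - 1) * (t - -1) * (t - a))
    (a * (a * (a - 1))) 1 (- a)) => [|t /eqP|t].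
  - by rewrite -eqr_oppLR eq_sym.
  - by rewrite !mulf_eq0 => /orP[/orP[]|] /eqP; apply: root4; rewrite ?expr1n.
  - by rewrite /f1 /f2 /f3 quartic_factor; ring.
pose d t := (1 + qchar (f1 t)) * (1 + qchar (f2 t)) * (1 - qchar (f3 t)).
have dsum : \sum_t d t = #|L|%:R + \sum_t qchar (f1 t) + \sum_t qchar (f2 t)
   + \sum_t qchar (f1 t * f2 t) - \sum_t qchar (f3 t)
   - \sum_t qchar (f1 t * f3 t) - \sum_t qchar (f2 t * f3 t)
   - \sum_t qchar (f1 t * f2 t * f3 t).
  have -> : #|L|%:R = \sum_(t : L) 1 :> int by rewrite sumr_const.
  rewrite -!big_split -!sumrB; apply: eq_bigr => t _ /=.
  rewrite (qcharM odd_card (f1 t * _)) !(qcharM odd_card (f1 t)).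
  by rewrite (qcharM odd_card (f2 t)) /d; ring.
have dle t : d t <= 8 * (if t \in odd_part then 1 else 0)
                    + 8 * (if t ^+ 4 == 1 then 1 else 0).
  rewrite inE /d -/(f1 t) -/(f2 t) -/(f3 t).
  have [t4|t4] := eqVneq (t ^+ 4) 1.
    have -> : f3 t = 0 by rewrite /f3 t4 subrr.
    rewrite qchar0 !andbF mulr0 add0r mulr1 subr0 mulr1.
    by have := qchar_bound (f1 t); have := qchar_bound (f2 t); nia.
  have f3t : f3 t != 0 by rewrite subr_eq0.
  have f1t : f1 t != 0.
    apply: contraNneq f3t => /eqP; rewrite mulf_eq0 (negbTE a_neq0) /= => /eqP e.
    have -> : f3 t = (t ^+ 2 - 1) * (t ^+ 2 + 1) by rewrite /f3; ring.
    by rewrite e mul0r.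
  have f2t : f2 t != 0.
    apply: contraNneq f3t => /eqP.
    rewrite !mulf_eq0 (negbTE a_neq0) (negbTE aN1) /= => /orP[] /eqP e;
    by rewrite /f3 quartic_factor e ?(mul0r, mulr0).
  by case/orP: (qcharP f1t) => /eqP->; case/orP: (qcharP f2t) => /eqP->;
     case/orP: (qcharP f3t) => /eqP->.
have : \sum_t d t <= 8 * #|odd_part|%:R + 32.
  apply: le_trans (ler_sum _ (fun t _ => dle t)) _.
  rewrite big_split -!mulr_sumr -!big_mkcond /= !sumr_const lerD2l.
  rewrite (_ : 32 = 8 * 4) // ler_pM2l // (ler_nat _ _ 4).
  by apply: leq_trans (card_quartic_fiber 1); rewrite cardsE.
rewrite dsum -[\sum_t qchar (t ^+ 4 - 1)]/(\sum_t qchar (f3 t)).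
move: s1 s2 s12 s13 s23 s123; lia.
Qed.

End InvariantSet.

Lemma periodic_of_surjective_in (T : finType) (f : T -> T) (A : {set T}) :
  (forall y, y \in A -> exists2 x, x \in A & f x = y) ->
  {in A, forall x, periodic f x}.
Proof.
move=> surj.
have sAf : A \subset f @: A.
  by apply/fintype.subsetP => y /surj[x xA <-]; apply: imset_f.
have fA : f @: A = A.
  by apply/esym/eqP; rewrite eqEcard sAf leq_imset_card.
have finj : {in A &, injective f} by apply/imset_injP; rewrite fA.
have fin : {homo f : x / x \in A} by move=> x xA; rewrite -fA imset_f.
move=> x xA; exists (fingraph.order f x); first exact: fingraph.order_gt0.
exact: (iter_order_in fin finj).
Qed.

Section RationalMaps.
Variable K : fieldType.
Implicit Types (f g : ratfun K) (n d : {poly K}).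

Definition reval (g : ratfun K) (q : {poly K}) : ratfun K :=
  (map_poly (fun c => c%:P%:F) q).[g].

Definition p1_quot (L : fieldType) (u v : L) : P1 L :=
  if v == 0 then None else Some (u / v).

Let cst : {rmorphism K -> ratfun K} := @tofrac {poly K} \o polyC.

Lemma reval_commr g : commr_rmorph cst g.
Proof. by move=> c; apply: mulrC. Qed.

Lemma revalE g : reval g =1 horner_morph (@reval_commr g).
Proof. by []. Qed.

Lemma revalC g c : reval g c%:P = c%:P%:F.
Proof. by rewrite revalE horner_morphC. Qed.

Lemma revalX g : reval g 'X = g.
Proof. by rewrite revalE horner_morphX. Qed.

Lemma revalD g p q : reval g (p + q) = reval g p + reval g q.
Proof. by rewrite !revalE rmorphD. Qed.

Lemma revalM g p q : reval g (p * q) = reval g p * reval g q.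
Proof. by rewrite !revalE rmorphM. Qed.

Lemma rnum_rden_fraction n d : d != 0 -> exists2 h, h != 0 &
  n = h * rnum (n%:F / d%:F) /\ d = h * rden (n%:F / d%:F).
Proof.
move=> d0; set f := _ / _.
have dF : d%:F != 0 :> ratfun K by rewrite tofrac_eq0.
have rF : (rden f)%:F != 0 :> ratfun K by rewrite tofrac_eq0 rden_neq0.
have cross : n * rden f = rnum f * d.
  apply/eqP; rewrite -tofrac_eq !tofracM -(eqr_div _ _ dF rF) -/f.
  by rewrite -ratfunE.
have /dvdpP[h dE] : rden f %| d.
  have := dvdp_mull n (dvdpp (rden f)).
  by rewrite cross Gauss_dvdpr // coprimep_sym coprimep_rnum_rden.
exists h; first by apply: contraNneq d0 => h0; rewrite dE h0 mul0r.
split => //; apply: (mulIf (rden_neq0 f)).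
by rewrite cross {1}dE mulrCA mulrA.
Qed.

Lemma rcomp_fraction n d g : reval g d != 0 ->
  rcomp (n%:F / d%:F) g = reval g n / reval g d.
Proof.
move=> gd0; have d0 : d != 0.
  by apply: contraNneq gd0 => ->; rewrite revalE rmorph0.
have [h h0 [nE dE]] := rnum_rden_fraction n d0.
rewrite /rcomp -!/(reval _ _); set f := _ / _ in nE dE *.
have gh0 : reval g h != 0.
  by apply: contraNneq gd0 => e; rewrite dE revalM e mul0r.
by rewrite nE dE !revalM -mulf_div divff // mul1r.
Qed.

Lemma p1_quotMl (L : fieldType) (c u v : L) : c != 0 ->
  p1_quot (c * u) (c * v) = p1_quot u v.
Proof.
move=> c0; rewrite /p1_quot mulf_eq0 (negbTE c0) /=.
by case: ifP => // _; rewrite -mulf_div divff // mul1r.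
Qed.

Lemma ratmap_fraction (L : fieldType) (iota : {rmorphism K -> L}) n d (t : L) :
  d != 0 ->
  (map_poly iota n).[t] != 0 \/ (map_poly iota d).[t] != 0 ->
  ratmap iota (n%:F / d%:F) (Some t) =
  p1_quot (map_poly iota n).[t] (map_poly iota d).[t].
Proof.
move=> d0; have [h h0 [nE dE]] := rnum_rden_fraction n d0.
set f := _ / _ in nE dE *; rewrite nE dE !rmorphM !hornerM => ht.
rewrite p1_quotMl //.
by case: ht; apply: contraNneq => ->; rewrite mul0r.
Qed.

Lemma ratmap_fraction_infty (L : fieldType) (iota : {rmorphism K -> L}) n d k :
  d != 0 -> (size n <= k.+1)%N -> (size d <= k.+1)%N ->
  n`_k != 0 \/ d`_k != 0 ->
  ratmap iota (n%:F / d%:F) None = p1_quot (iota n`_k) (iota d`_k).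
Proof.
move=> d0; have [h h0 [nE dE]] := rnum_rden_fraction n d0.
set f := _ / _ in nE dE * => sn sd nd; rewrite /ratmap !size_map_poly.
set r := rnum f in nE *; set s := rden f in dE *.
have s0 : s != 0 by apply: rden_neq0.
set e := (maxn _ _).-1.
have se : (size s <= e.+1)%N.
  by rewrite /e prednK ?leq_maxr // leq_max (size_poly_gt0 s) s0 orbT.
have re : (size r <= e.+1)%N.
  by rewrite /e prednK ?leq_maxl // leq_max (size_poly_gt0 s) s0 orbT.
have top (q : {poly K}) : (size q <= e.+1)%N ->
    (h * q)`_((size h).-1 + e) = lead_coef h * q`_e.
  move=> sq; have hs : (size h).-1.+1 = size h by rewrite prednK // size_poly_gt0.
  have lt1 : ((size h).-1 < ((size h).-1 + e).+1)%N by rewrite ltnS leq_addr.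
  rewrite coefM (bigD1 (Ordinal lt1)) //= addKn big1 ?addr0 // => i.
  rewrite -val_eqE /= neq_ltn => /orP[lt|gt].
    by rewrite (nth_default 0 (s := q)) ?mulr0 // (leq_trans sq) //; lia.
  by rewrite (nth_default 0 (s := h)) ?mul0r //; apply: leq_trans gt; rewrite hs.
have lh : lead_coef h != 0 by rewrite lead_coef_eq0.
have e_top : r`_e != 0 \/ s`_e != 0.
  rewrite /e; case: (leqP (size r) (size s)) => rs.
    by right; rewrite -lead_coefE lead_coef_eq0.
  left; rewrite -lead_coefE lead_coef_eq0 -size_poly_gt0.
  by apply: leq_ltn_trans rs.
have ek : ((size h).-1 + e = k)%N.
  apply/eqP; rewrite eqn_leq; apply/andP; split.
    rewrite leqNgt; apply/negP => lt; case: e_top => /negP[];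
      apply/eqP/(mulfI lh).
      by rewrite mulr0 -top // -nE nth_default // (leq_trans sn).
    by rewrite mulr0 -top // -dE nth_default // (leq_trans sd).
  rewrite leqNgt; apply/negP => lt.
  have hs : (size h).-1.+1 = size h by rewrite prednK // size_poly_gt0.
  case: nd => /negP[]; apply/eqP.
    rewrite nE nth_default // (leq_trans (size_polyMleq _ _)) //; lia.
  rewrite dE nth_default // (leq_trans (size_polyMleq _ _)) //; lia.
rewrite !coef_map -/(p1_quot _ _) nE dE -ek !top // !rmorphM p1_quotMl //.
by rewrite fmorph_eq0.
Qed.

End RationalMaps.

Lemma sqr_fraction (E : fieldType) (x y c : E) : y != 0 ->
  x / y * (x / y) + c = (x ^+ 2 + c * y ^+ 2) / y ^+ 2.
Proof. by move=> y0; field. Qed.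

Lemma linear_fraction (E : fieldType) (u v x y : E) : y != 0 ->
  u * (x / y) + v = (u * x + v * y) / y.
Proof. by move=> y0; field. Qed.

Lemma divf_div (E : fieldType) (x y z : E) : z != 0 ->
  (x / z) / (y / z) = x / y.
Proof. by move=> z0; rewrite invf_div mulrA divfK. Qed.

Lemma divf_neq0 (E : fieldType) (x y : E) : x != 0 -> y != 0 -> x / y != 0.
Proof. by move=> x0 y0; rewrite mulf_neq0 ?invr_eq0. Qed.

Section Conjugation.
Variables (K : fieldType) (a : K) (M : 'M[K]_2).
Hypotheses (two0 : 2%:R != 0 :> K) (a0 : a != 0) (M_unit : M \in unitmx).

Let N : 'M[K]_2 := invmx M.
Let A : {poly K} := M 0 0 *: 'X + (M 0 1)%:P.
Let B : {poly K} := M 1 0 *: 'X + (M 1 1)%:P.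
Let P : {poly K} := A ^+ 2 + a *: B ^+ 2.
Let Q : {poly K} := A ^+ 2 - a *: B ^+ 2.

Lemma mulmx2E (C D : 'M[K]_2) i j :
  (C *m D) i j = C i 0 * D 0 j + C i 1 * D 1 j.
Proof.
rewrite mxE !big_ord_recl big_ord0 addr0.
by have -> : lift ord0 ord0 = 1 :> 'I_2 by apply: val_inj.
Qed.

Let MN i j : M i 0 * N 0 j + M i 1 * N 1 j = (i == j)%:R.
Proof. by rewrite -mulmx2E mulmxV // mxE. Qed.

Let NM i j : N i 0 * M 0 j + N i 1 * M 1 j = (i == j)%:R.
Proof. by rewrite -mulmx2E mulVmx // mxE. Qed.

Let det0 : M 0 0 * M 1 1 - M 0 1 * M 1 0 != 0.
Proof.
have : (M 0 0 * M 1 1 - M 0 1 * M 1 0) * (N 0 0 * N 1 1 - N 0 1 * N 1 0) = 1.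
  transitivity ((M *m N) 0 0 * (M *m N) 1 1 - (M *m N) 0 1 * (M *m N) 1 0).
    by rewrite !mulmx2E; ring.
  by rewrite mulmxV // !mxE /= mulr1 mulr0 subr0.
by apply: contra_eq_neq => ->; rewrite mul0r eq_sym oner_eq0.
Qed.

Lemma linear_sqr (u v : K) :
  (u *: 'X + v%:P) ^+ 2 = (u ^+ 2) *: 'X^2 + (u * v *+ 2) *: 'X + (v ^+ 2)%:P.
Proof. by rewrite -!mul_polyC; ring. Qed.

Let coef0E u v : (u *: A ^+ 2 + v *: B ^+ 2)`_0 =
  u * M 0 1 ^+ 2 + v * M 1 1 ^+ 2.
Proof. by rewrite !linear_sqr !coefE /=; ring. Qed.

Let coef1E u v : (u *: A ^+ 2 + v *: B ^+ 2)`_1 =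
  u * (M 0 0 * M 0 1 *+ 2) + v * (M 1 0 * M 1 1 *+ 2).
Proof. by rewrite !linear_sqr !coefE /=; ring. Qed.

Let coef2E u v : (u *: A ^+ 2 + v *: B ^+ 2)`_2 =
  u * M 0 0 ^+ 2 + v * M 1 0 ^+ 2.
Proof. by rewrite !linear_sqr !coefE /=; ring. Qed.

Let sqr_free u v : u *: A ^+ 2 + v *: B ^+ 2 = 0 -> u = 0 /\ v = 0.
Proof.
move=> e; have := coef0E u v; have := coef1E u v; have := coef2E u v.
rewrite e !coef0 => e2 e1 e0.
have d2 : (M 0 0 * M 1 1 - M 0 1 * M 1 0) ^+ 2 != 0 by rewrite expf_neq0.
split; apply: (mulIf d2); rewrite mul0r.
  transitivity (M 1 1 ^+ 2 * 0 - M 1 0 * M 1 1 * 0 + M 1 0 ^+ 2 * 0);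
    last by rewrite !mulr0 subr0 addr0.
  by rewrite {1}e2 {1}e1 e0; ring.
transitivity (M 0 1 ^+ 2 * 0 - M 0 0 * M 0 1 * 0 + M 0 0 ^+ 2 * 0);
  last by rewrite !mulr0 subr0 addr0.
by rewrite {1}e2 {1}e1 e0; ring.
Qed.

Let den_neq0 : (N 1 0 + N 1 1) *: A ^+ 2 + (a * (N 1 0 - N 1 1)) *: B ^+ 2 != 0.
Proof.
apply/eqP => /sqr_free[/eqP e1 /eqP].
rewrite mulf_eq0 (negbTE a0) subr_eq0 /= => /eqP e2.
move: e1; rewrite e2 -mulr2n -mulr_natl mulf_eq0 (negbTE two0) /= => /eqP e3.
by have /eqP := NM 1 1; rewrite e2 e3 !mul0r addr0 eqxx eq_sym oner_eq0.
Qed.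

Lemma conjugate_fraction :
  rcomp (mobius N) (rcomp (('X^2 + a%:P)%:F / ('X^2 - a%:P)%:F) (mobius M)) =
  ((N 0 0 + N 0 1) *: A ^+ 2 + (a * (N 0 0 - N 0 1)) *: B ^+ 2)%:F /
  ((N 1 0 + N 1 1) *: A ^+ 2 + (a * (N 1 0 - N 1 1)) *: B ^+ 2)%:F.
Proof.
have B0 : B != 0.
  apply/eqP => b0.
  have := sqr_free (u := 0) (v := 1); rewrite scale0r b0 expr0n scaler0 add0r.
  by case=> // _ /eqP; rewrite oner_eq0.
have BF : B%:F != 0 :> ratfun K by rewrite tofrac_eq0.
have B2F : B%:F ^+ 2 != 0 :> ratfun K by rewrite -tofracXn tofrac_eq0 expf_neq0.
have QF : Q%:F != 0 :> ratfun K.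
  rewrite tofrac_eq0 /Q; apply/eqP => q0.
  have [] := sqr_free (u := 1) (v := - a); first by rewrite scale1r scaleNr.
  by move/eqP; rewrite oner_eq0.
have quad c : reval (mobius M) ('X^2 + c%:P) =
    (A ^+ 2 + c *: B ^+ 2)%:F / B%:F ^+ 2.
  rewrite expr2 revalD revalM revalX revalC /mobius -/A -/B -(mul_polyC c).
  rewrite (tofracD (A ^+ 2)) (tofracM c%:P) (tofracXn 2 A) (tofracXn 2 B).
  move: BF; move: (A%:F) (B%:F) (c%:P%:F) => x y z.
  exact: (@sqr_fraction (ratfun K)).
have -> : rcomp (('X^2 + a%:P)%:F / ('X^2 - a%:P)%:F) (mobius M) = P%:F / Q%:F.
  have QE : reval (mobius M) ('X^2 - a%:P) = Q%:F / B%:F ^+ 2.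
    by rewrite -polyCN quad scaleNr.
  rewrite rcomp_fraction QE.
    rewrite quad -/P; apply: (@divf_div (ratfun K)).
    exact: B2F.
  exact: (@divf_neq0 (ratfun K)).
have lin u v : reval (P%:F / Q%:F) (u *: 'X + v%:P) =
    ((u + v) *: A ^+ 2 + (a * (u - v)) *: B ^+ 2)%:F / Q%:F.
  have -> : (u + v) *: A ^+ 2 + (a * (u - v)) *: B ^+ 2 = u%:P * P + v%:P * Q.
    by rewrite /P /Q -!mul_polyC; ring.
  rewrite -mul_polyC revalD revalM revalX !revalC.
  rewrite (tofracD (u%:P * P)) (tofracM u%:P) (tofracM v%:P).
  exact: (@linear_fraction (ratfun K)).
rewrite {1}/mobius rcomp_fraction lin.
  by rewrite lin; apply: (@divf_div (ratfun K)).
apply: (@divf_neq0 (ratfun K)) QF; rewrite tofrac_eq0; exact: den_neq0.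
Qed.

Variables (L : fieldType) (iota : {rmorphism K -> L}).

Let m i j := iota (M i j).
Let n i j := iota (N i j).

Let mn i j : m i 0 * n 0 j + m i 1 * n 1 j = (i == j)%:R.
Proof. by rewrite -!rmorphM -rmorphD MN rmorph_nat. Qed.

Definition mobius_point (t : L) : P1 L :=
  p1_quot (iota (invmx M 0 0) * t + iota (invmx M 0 1))
          (iota (invmx M 1 0) * t + iota (invmx M 1 1)).

Let mobius_vec t :
  m 0 0 * (n 0 0 * t + n 0 1) + m 0 1 * (n 1 0 * t + n 1 1) = t /\
  m 1 0 * (n 0 0 * t + n 0 1) + m 1 1 * (n 1 0 * t + n 1 1) = 1.
Proof.
split.
  transitivity ((m 0 0 * n 0 0 + m 0 1 * n 1 0) * t +
    (m 0 0 * n 0 1 + m 0 1 * n 1 1)).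
    by ring.
  by rewrite !mn /= mul1r addr0.
transitivity ((m 1 0 * n 0 0 + m 1 1 * n 1 0) * t +
  (m 1 0 * n 0 1 + m 1 1 * n 1 1)).
  by ring.
by rewrite !mn /= mul0r add0r.
Qed.

Lemma mobius_point_inj : injective mobius_point.
Proof.
pose inv (x : P1 L) := if x is Some r
  then (m 0 0 * r + m 0 1) / (m 1 0 * r + m 1 1) else m 0 0 / m 1 0.
apply: (can_inj (g := inv)) => t; have [] := mobius_vec t.
rewrite /mobius_point /p1_quot -/N -!/(n _ _).
set X := _ + n 0 1; set Y := _ + n 1 1 => e0 e1.
have [Y0|Y0] := eqVneq Y 0; rewrite /=.
  move: e0 e1; rewrite Y0 !mulr0 !addr0 => <- e1.
  have m10 : m 1 0 != 0.
    by apply: contra_eq_neq e1 => ->; rewrite mul0r eq_sym oner_eq0.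
  by apply: (mulIf m10); rewrite divfK // -mulrA [X * _]mulrC e1 mulr1.
have -> : m 1 0 * (X / Y) + m 1 1 = Y^-1 by rewrite -[RHS]mul1r -e1; field.
have -> : m 0 0 * (X / Y) + m 0 1 = t / Y by rewrite -[in RHS]e0; field.
by rewrite invrK divfK.
Qed.

Lemma ratmap_conjugate (t s : L) :
  t ^+ 2 - iota a != 0 -> s * (t ^+ 2 - iota a) = t ^+ 2 + iota a ->
  ratmap iota
    (rcomp (mobius N) (rcomp (('X^2 + a%:P)%:F / ('X^2 - a%:P)%:F) (mobius M)))
    (mobius_point t) = mobius_point s.
Proof.
move=> ta st; rewrite conjugate_fraction.
have ev u v r : (map_poly iota (u *: A ^+ 2 + v *: B ^+ 2)).[r] =
    iota u * (m 0 0 * r + m 0 1) ^+ 2 + iota v * (m 1 0 * r + m 1 1) ^+ 2.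
  by rewrite /A /B -!mul_polyC !(rmorphD, rmorphM, rmorphXn) /=
    !map_polyC !map_polyX !hornerE.
have sz u v : (size (u *: A ^+ 2 + v *: B ^+ 2)%R <= 3)%N.
  apply/leq_sizeP => j j3; rewrite !linear_sqr !coefE.
  by case: j j3 => [|[|[|j]]] //= _; rewrite !(mulr0, addr0).
have [v0 v1] := mobius_vec t.
have [w0 w1] := mobius_vec s.
have s0 : n 0 0 * s + n 0 1 != 0 \/ n 1 0 * s + n 1 1 != 0.
  case: (eqVneq (n 0 0 * s + n 0 1) 0) => e; [right | by left].
  by apply: contra_eq_neq w1 => e'; rewrite e e' !mulr0 addr0 eq_sym oner_eq0.
rewrite /mobius_point -/N -!/(n _ _).
have comb u v c : iota (u + v) * (t * c) ^+ 2 + iota (a * (u - v)) * c ^+ 2 =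
    (t ^+ 2 - iota a) * c ^+ 2 * (iota u * s + iota v).
  transitivity (c ^+ 2 * (iota u * (t ^+ 2 + iota a)
    + iota v * (t ^+ 2 - iota a))).
    by rewrite rmorphM rmorphB rmorphD; ring.
  by rewrite -st; ring.
rewrite {1}/p1_quot; set X := _ + n 0 1 in v0 v1 *; set Y := _ + n 1 1 in v0 v1 *.
have [Y0|Y0] := eqVneq Y 0.
  move: v0 v1; rewrite Y0 !mulr0 !addr0 => v0 v1.
  have X0 : X != 0.
    by apply: contra_eq_neq v1 => ->; rewrite mulr0 eq_sym oner_eq0.
  have mE : m 0 0 = t * X^-1 by rewrite -v0 mulfK.
  have mE' : m 1 0 = X^-1 by rewrite -[RHS]mul1r -v1 mulfK.
  have c0 : (t ^+ 2 - iota a) * X^-1 ^+ 2 != 0.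
    by rewrite mulf_neq0 // expf_neq0 ?invr_eq0.
  have co u v : iota ((u + v) *: A ^+ 2 + (a * (u - v)) *: B ^+ 2)`_2 =
      (t ^+ 2 - iota a) * X^-1 ^+ 2 * (iota u * s + iota v).
    by rewrite coef2E -comb -mE -mE' /m -!rmorphXn -!rmorphM -rmorphD.
  rewrite (@ratmap_fraction_infty _ _ iota _ _ 2) ?sz ?den_neq0 //.
    by rewrite !co p1_quotMl.
  rewrite -!(fmorph_eq0 iota) !co !(mulrI_eq0 _ (mulfI c0)); exact: s0.
have c0 : (t ^+ 2 - iota a) * Y^-1 ^+ 2 != 0.
  by rewrite mulf_neq0 // expf_neq0 ?invr_eq0.
have fE : m 1 0 * (X / Y) + m 1 1 = Y^-1 by rewrite -[RHS]mul1r -v1; field.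
have fE' : m 0 0 * (X / Y) + m 0 1 = t * Y^-1 by rewrite -[in RHS]v0; field.
rewrite ratmap_fraction ?den_neq0 // !ev fE fE' !comb.
  by rewrite p1_quotMl.
by rewrite !(mulrI_eq0 _ (mulfI c0)).
Qed.
End Conjugation.

Lemma limn_einf_ge (R : realType) (u : nat -> R) (c : R) :
  (forall e, 0 < e -> exists k, forall n, (k <= n)%N -> c - e <= u n) ->
  (c%:E <= limn_einf (fun n => (u n)%:E))%E.
Proof.
move=> cu; apply/lee_addgt0Pr => e e0; have [k kP] := cu e e0.
rewrite -leeBlDr // limn_einf_lim.
have -> : limn (einfs (fun n => (u n)%:E)) =
    ereal_sup (range (einfs (fun n => (u n)%:E))).
  by apply/cvg_lim; [exact: ereal_hausdorff | exact: cvg_einfs_sup].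
apply: (@le_trans _ _ (einfs (fun n => (u n)%:E) k)).
  by apply: le_ereal_inf_tmp => _ [n /= kn <-]; rewrite -EFinB lee_fin kP.
by apply: ereal_sup_ubound; exists k.
Qed.

Lemma asymptotic_bound (R : realFieldType) (e q S T : R) :
  0 < e -> 2 <= q -> 63 <= e * q -> 32 <= e ^+ 2 * q ->
  S ^+ 2 * (q - 1) <= 16 * q ^+ 2 -> q - S - 62 <= 8 * T ->
  1 / 8 - e <= T / (q + 1).
Proof.
move=> e0 q2 eq1 eq2 S1 S2.
have S2q : S ^+ 2 <= (e * q) ^+ 2.
  have : S ^+ 2 <= 32 * q by nra.
  by move/le_trans; apply; rewrite exprMn expr2 mulrA ler_pM2r; nra.
have eq0 : 0 <= e * q by nra.
have Seq : S <= e * q.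
  apply: le_trans (ler_norm S) _.
  by rewrite -ler_sqr ?nnegrE // real_normK ?num_real.
by rewrite ler_pdivlMr; nra.
Qed.

Theorem theorem2p7 (R : realType) (p : nat) (p_prime : prime p)
    (p_mod4 : p = 1 %[mod 4])
    (a : 'F_p) (ha : a ^+ 2 + 1 = 0)
    (phi : ratfun 'F_p)
    (hphi : mobius_conjugate phi (('X^2 + a%:P)%:F / ('X^2 - a%:P)%:F))
    (F : nat -> finFieldType) (hF : forall n : nat, #|F n| = (p ^ n.+1)%N)
    (iota : forall n : nat, {rmorphism 'F_p -> F n}) :
  ((1 / 8 : R)%:E <=
   limn_einf (fun n : nat =>
     ((nPer (iota n) phi)%:R / (p ^ n.+1 + 1)%:R : R)%:E))%E.
Proof.
have p_odd : odd p by move: p_mod4; lia.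
have F_odd n : odd #|F n| by rewrite hF oddX p_odd orbT.
have a_sqr : a ^+ 2 = -1 by apply/eqP; rewrite -addr_eq0 ha.
have two0 : 2%:R != 0 :> 'F_p.
  by rewrite -(fmorph_eq0 (iota 0%N)) rmorph_nat two_neq0.
have a0 : a != 0 by rewrite -sqrf_eq0 a_sqr oppr_eq0 oner_eq0.
case: hphi => M M_unit ->.
set psi := rcomp _ _.
have ia n : iota n a ^+ 2 = -1 by rewrite -rmorphXn a_sqr rmorphN1.
have per_ge n : (#|odd_part (iota n a)| <= nPer (iota n) psi)%N.
  rewrite -(card_imset _ (mobius_point_inj (iota := iota n) M_unit)).
  apply/subset_leq_card/fintype.subsetP => x xT; rewrite inE; apply/asboolP.
  apply: periodic_of_surjective_in xT => _ /imsetP[t tT ->].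
  have [y yT [ya yt]] := odd_part_preimage (F_odd n) (ia n) tT.
  exists (mobius_point M (iota n) y); first exact: imset_f.
  exact: ratmap_conjugate.
apply: limn_einf_ge => e e0.
exists (Num.truncn (63 / e + 32 / e ^+ 2)).+1 => n kn.
have [S S1 S2] := card_odd_part (F_odd n) (ia n).
rewrite hF in S1 S2.
set q := (p ^ n.+1)%N in S1 S2 *.
have nq : (n < q)%N := ltnW (ltn_expl n.+1 (prime_gt1 p_prime)).
have qe : 63 / e + 32 / e ^+ 2 <= q%:R :> R.
  apply: ltW; apply: lt_le_trans (truncnS_gt _) _.
  by rewrite ler_nat (leq_trans kn) // ltnW.
have e2 : 0 < e ^+ 2 by rewrite exprn_gt0.
have q63 : 63 <= e * q%:R.
  rewrite mulrC -ler_pdivrMr //; apply: le_trans qe; rewrite lerDl.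
  by rewrite divr_ge0 // ltW.
have q32 : 32 <= e ^+ 2 * q%:R.
  rewrite mulrC -ler_pdivrMr //; apply: le_trans qe; rewrite lerDr.
  by rewrite divr_ge0 // ltW.
rewrite natrD.
apply: (@asymptotic_bound _ e _ (S%:~R)) => //.
- by rewrite (ler_nat _ 2) (leq_trans _ nq) // ltnS (leq_trans _ kn).
- have : (S ^+ 2 * (q%:R - 1))%:~R <= (16 * q%:R ^+ 2)%:~R :> R.
    by rewrite ler_int.
  by rewrite !(rmorphM, rmorphXn, rmorphB) /= rmorph1 !rmorph_nat.
- apply: (@le_trans _ _ (8 * #|odd_part (iota n a)|%:R)); last first.
    by rewrite ler_pM2l // ler_nat.
  have : (q%:R - S - 62)%:~R <= (8 * #|odd_part (iota n a)|%:R)%:~R :> R.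
    by rewrite ler_int.
  by rewrite !(rmorphM, rmorphB) /= !rmorph_nat.
Qed.
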